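(* Let $G$ and $H$ be critical graphs. Then $\Psi(G\,\nabla H)=\Psi(G)+\Psi(H)$.
   Context: All graphs are finite and simple; $|G|$ denotes the number of vertices of $G$. A coloring of a graph $G=(V,E)$ is a surjective map $\ell:V\to C$ onto a finite set $C$ of colors; it need not be proper. It is pseudocomplete if for any two distinct colors $i,j\in C$ there is an edge $uv\in E$ with $\{\ell(u),\ell(v)\}=\{i,j\}$. The pseudoachromatic number $\Psi(G)$ is the greatest number of colors used in a pseudocomplete coloring of $G$ (so $\Psi$ of the graph with no vertices is $0$). $G\,\nabla H$ is the join: the disjoint union of $G$ and $H$ together with all edges between a vertex of $G$ and a vertex of $H$. For an integer $0\le k\le |G|$, $\operatorname{mpd}_G(k)=\min\{\Psi(G)-\Psi(G\setminus X) : X\subseteq V,\ |X|=k\}$, where $G\setminus X$ is the subgraph induced on $V\setminus X$. $G$ is critical if $\operatorname{mpd}_G(k)\ge\lceil k/2\rceil$ for all $0\le k\le |G|$. *)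

(* Defs.v *)
From mathcomp Require Import all_boot.

Set Implicit Arguments.
Unset Strict Implicit.
Unset Printing Implicit Defensive.

Record sgraph := SGraph {
  vertex :> finType;
  edge : rel vertex;
  edge_sym : symmetric edge;
  edge_irrefl : irreflexive edge
}.

Section Induced.
Variables (G : sgraph) (S : {set G}).

Definition induced_edge : rel {x : G | x \in S} :=
  fun x y => edge (val x) (val y).

Lemma induced_edge_sym : symmetric induced_edge.
Proof. by move=> x y; apply: edge_sym. Qed.

Lemma induced_edge_irrefl : irreflexive induced_edge.
Proof. by move=> x; apply: edge_irrefl. Qed.

Definition induced : sgraph := SGraph induced_edge_sym induced_edge_irrefl.

End Induced.

Definition delete (G : sgraph) (X : {set G}) : sgraph := induced (~: X).

Section Join.
Variables G H : sgraph.

Definition join_edge : rel (G + H)%type := fun u v =>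
  match u, v with
  | inl x, inl y => edge x y
  | inr x, inr y => edge x y
  | _, _ => true
  end.

Lemma join_edge_sym : symmetric join_edge.
Proof. by move=> [x|x] [y|y] //=; apply: edge_sym. Qed.

Lemma join_edge_irrefl : irreflexive join_edge.
Proof. by move=> [x|x]; apply: edge_irrefl. Qed.

Definition graph_join : sgraph := SGraph join_edge_sym join_edge_irrefl.

End Join.

Definition coloring (G : sgraph) (C : finType) (l : G -> C) : bool :=
  [forall c, exists v, l v == c].

Definition pseudocomplete (G : sgraph) (C : finType) (l : G -> C) : bool :=
  [forall i, forall j, (i != j) ==>
    [exists u, exists v, edge u v && ([set l u; l v] == [set i; j])]].

Definition pseudocolorable (G : sgraph) (k : nat) : bool :=
  [exists l : {ffun G -> 'I_k}, coloring l && pseudocomplete l].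

(* A coloring is surjective, so it uses at most #|G| colors: the bound on k
   excludes nothing (see Psi_max and Psi_attained). *)
Definition Psi (G : sgraph) : nat :=
  \max_(k < #|G|.+1 | pseudocolorable G k) k.

(* By Psi_delete, the truncated subtraction is exact; the initial value Psi G
   is an upper bound of all the terms, so it does not affect the minimum when
   k <= #|G| (see mpd_le and mpd_attained). *)
Definition mpd (G : sgraph) (k : nat) : nat :=
  \big[minn/Psi G]_(X : {set G} | #|X| == k) (Psi G - Psi (delete X)).

Definition critical (G : sgraph) : Prop :=
  forall k : nat, k <= #|G| -> uphalf k <= mpd G k.

Lemma coloring_card (G : sgraph) (C : finType) (l : G -> C) :
  coloring l -> #|C| <= #|G|.
Proof.
move=> /forallP sl.
have <- : #|[set l x | x in G]| = #|C|.
  by apply: eq_card => c; have /existsP[v /eqP <-] := sl c; rewrite imset_f.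
exact: leq_imset_card.
Qed.

Lemma pseudocolorable_card (G : sgraph) (C : finType) (l : G -> C) :
  coloring l -> pseudocomplete l -> pseudocolorable G #|C|.
Proof.
move=> /forallP sl /forallP pl; apply/existsP.
exists [ffun v => enum_rank (l v)]; apply/andP; split.
  apply/forallP => c; have /existsP[v /eqP lv] := sl (enum_val c).
  by apply/existsP; exists v; rewrite ffunE lv enum_valK.
apply/forallP => i; apply/forallP => j; apply/implyP => ij.
have /forallP/(_ (enum_val j))/implyP := pl (enum_val i).
rewrite (inj_eq enum_val_inj) => /(_ ij)/existsP[u /existsP[v /andP[uv /eqP e]]].
apply/existsP; exists u; apply/existsP; exists v; rewrite uv /= !ffunE.
by have := congr1 (fun A : {set C} => enum_rank @: A) e; rewrite !imsetU1 !imset_set1 !enum_valK => ->.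
Qed.

Lemma Psi_max (G : sgraph) (C : finType) (l : G -> C) :
  coloring l -> pseudocomplete l -> #|C| <= Psi G.
Proof.
move=> cl pl; have lt : #|C| < #|G|.+1 by rewrite ltnS (coloring_card cl).
exact: (leq_bigmax_cond (Ordinal lt) (pseudocolorable_card cl pl)).
Qed.

Lemma Psi_attained (G : sgraph) : pseudocolorable G (Psi G).
Proof.
have [k0 pk0] : exists k : 'I_#|G|.+1, pseudocolorable G k.
  case: (posnP #|G|) => [G0|/card_gt0P[x _]].
    exists ord0; apply/existsP.
    have f : G -> 'I_0 by move=> v; move: (card0_eq G0 v); rewrite inE.
    exists (finfun f).
    by apply/andP; split; apply/forallP; case.
  have h : 1 < #|G|.+1 by rewrite ltnS; apply/card_gt0P; exists x.
  exists (Ordinal h); apply/existsP; exists [ffun=> ord0]; apply/andP; split.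
    by apply/forallP=> c; apply/existsP; exists x; rewrite ffunE ord1.
  by apply/forallP=> i; apply/forallP=> j; rewrite (ord1 i) (ord1 j) eqxx.
rewrite /Psi (bigop.bigmax_eq_arg k0) //.
by case: arg_maxnP.
Qed.

Lemma Psi_delete (G : sgraph) (X : {set G}) : Psi (delete X) <= Psi G.
Proof.
have /existsP[l /andP[cl pl]] := Psi_attained (delete X).
case: (posnP (Psi (delete X))) => [-> //|gt0].
pose c0 := Ordinal gt0.
pose m (v : G) : 'I_(Psi (delete X)) :=
  if insub v is Some w then l w else c0.
have mE (w : delete X) : m (val w) = l w by rewrite /m valK.
rewrite -[X in X <= _]card_ord; apply: (@Psi_max G _ m).
  apply/forallP => c; have /existsP[w /eqP lw] := forallP cl c.
  by apply/existsP; exists (val w); rewrite mE lw.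
apply/forallP => i; apply/forallP => j; apply/implyP => ij.
have /existsP[u /existsP[v /andP[uv e]]] := implyP (forallP (forallP pl i) j) ij.
by apply/existsP; exists (val u); apply/existsP; exists (val v); rewrite !mE e andbT.
Qed.

Lemma mpd_le (G : sgraph) (X : {set G}) :
  mpd G #|X| <= Psi G - Psi (delete X).
Proof.
rewrite /mpd; have: X \in index_enum _ by rewrite mem_index_enum.
elim: (index_enum _) => //= Y s IH; rewrite inE big_cons.
case/predU1P => [<-|Xs]; first by rewrite eqxx geq_minl.
by case: ifP => _; [apply: leq_trans (geq_minr _ _) (IH Xs) | apply: IH].
Qed.

Lemma mpd_attained (G : sgraph) (k : nat) : k <= #|G| ->
  exists2 X : {set G}, #|X| = k & mpd G k = Psi G - Psi (delete X).
Proof.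
move=> kG.
have [X0 cX0] : exists X : {set G}, #|X| = k.
  exists [set x in take k (enum G)]; rewrite cardsE (card_uniqP _).
    by rewrite size_takel // -cardE.
  exact/take_uniq/enum_uniq.
have [//|e] : (exists2 X : {set G}, #|X| = k & mpd G k = Psi G - Psi (delete X))
    \/ mpd G k = Psi G.
  rewrite /mpd; apply: (big_ind (fun m =>
    (exists2 X : {set G}, #|X| = k & m = Psi G - Psi (delete X)) \/ m = Psi G))
    => [|x y hx hy|X /eqP cX]; first by right.
    by rewrite /minn; case: ifP.
  by left; exists X.
exists X0 => //; apply/eqP; rewrite eqn_leq -{1}cX0 mpd_le /= e.
exact: leq_subr.
Qed.

(* Main.v *)
Require Import Defs.
From mathcomp Require Import all_boot.

Set Implicit Arguments.
Unset Strict Implicit.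
Unset Printing Implicit Defensive.

(** For the lower bound, optimal colorings of the two sides with disjoint
    palettes form a pseudocomplete coloring of the join, since every vertex of
    [G] is adjacent to every vertex of [H] ([Psi_join_ge]).

    Conversely, take an optimal coloring of the join and sort its colors into
    those occurring only in [G], those occurring only in [H], and the mixed
    ones, in numbers [a], [b] and [m]. Two colors occurring only in [G] can
    only meet along an edge of [G] ([meets_preimage]). Thus deleting the
    vertices of [G] with a mixed color leaves a graph that is pseudocompletely
    colored with [a] colors ([Psi_delete_color_bound]). At least [m] vertices were deleted, so criticality of [G] gives
    [a + uphalf m <= Psi G] ([critical_color_bound]). In the same way
    [b + uphalf m <= Psi H]. Since [m <= uphalf m + uphalf m], adding the two
    bounds gives [a + b + m <= Psi G + Psi H]. *)

Definition meets (G : sgraph) (C : finType) (l : G -> C) (i j : C) : bool :=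
  [exists u, exists v, edge u v && ([set l u; l v] == [set i; j])].

Lemma meets_sym (G : sgraph) (C : finType) (l : G -> C) (i j : C) :
  meets l i j = meets l j i.
Proof. by rewrite /meets setUC. Qed.

Lemma pseudocompleteP (G : sgraph) (C : finType) (l : G -> C) :
  reflect (forall i j, i != j -> meets l i j) (pseudocomplete l).
Proof.
apply: (iffP forallP) => [pl i j|ml i]; first exact: implyP (forallP (pl i) j).
by apply/forallP => j; apply/implyP; apply: ml.
Qed.

Lemma meets_image (G J : sgraph) (C D : finType) (e : G -> J) (g : C -> D)
    (m : G -> C) (l : J -> D) (i j : C) :
  (forall u v, edge u v -> edge (e u) (e v)) ->
  (forall u, l (e u) = g (m u)) ->
  meets m i j -> meets l (g i) (g j).
Proof.
move=> ee le /existsP[u /existsP[v /andP[uv /eqP E]]].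
apply/existsP; exists (e u); apply/existsP; exists (e v).
by rewrite ee //= !le -!(imset_set1 g) -!imsetU E.
Qed.

(** An edge realizing the pair [i], [j] has both ends colored [i] or [j], so it
    is an edge of [G] as soon as these colors do not occur outside [G]. *)
Lemma meets_preimage (G J : sgraph) (C : finType) (e : G -> J)
    (l : J -> C) (i j : C) :
  (forall u v, edge (e u) (e v) -> edge u v) ->
  (forall w, l w \in [set i; j] -> exists u, w = e u) ->
  meets l i j -> meets (l \o e) i j.
Proof.
move=> ee inG /existsP[w /existsP[x /andP[wx /eqP E]]].
have [u eu] : exists u, w = e u by apply: inG; rewrite -E set21.
have [v ev] : exists v, x = e v by apply: inG; rewrite -E set22.
apply/existsP; exists u; apply/existsP; exists v.
by rewrite ee /= -?eu -?ev // E eqxx.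
Qed.

Section JoinColorings.
Variables (G H : sgraph) (C D : finType) (l : G -> C) (m : H -> D).

Definition sum_coloring (w : graph_join G H) : C + D :=
  match w with inl u => inl (l u) | inr v => inr (m v) end.

Lemma sum_coloring_surj : coloring l -> coloring m -> coloring sum_coloring.
Proof.
move=> /forallP cl /forallP cm; apply/forallP => -[c|d]; apply/existsP.
  by have /existsP[u /eqP <-] := cl c; exists (inl u).
by have /existsP[v /eqP <-] := cm d; exists (inr v).
Qed.

Lemma sum_coloring_pseudocomplete :
  coloring l -> coloring m -> pseudocomplete l -> pseudocomplete m ->
  pseudocomplete sum_coloring.
Proof.
move=> /forallP cl /forallP cm /pseudocompleteP pl /pseudocompleteP pm.
have mixed c d : meets sum_coloring (inl c) (inr d).
  have /existsP[u /eqP <-] := cl c; have /existsP[v /eqP <-] := cm d.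
  by apply/existsP; exists (inl u); apply/existsP; exists (inr v) => /=.
apply/pseudocompleteP => -[i|i] [j|j] ij.
- by apply: (@meets_image G (graph_join G H) _ _ inl inl l) => //; apply: pl.
- exact: mixed.
- by rewrite meets_sym.
- by apply: (@meets_image H (graph_join G H) _ _ inr inr m) => //; apply: pm.
Qed.

End JoinColorings.

Lemma Psi_join_ge (G H : sgraph) : Psi G + Psi H <= Psi (graph_join G H).
Proof.
have /existsP[l /andP[cl pl]] := Psi_attained G.
have /existsP[m /andP[cm pm]] := Psi_attained H.
rewrite -[X in X + _]card_ord -[X in _ + X]card_ord -card_sum.
exact: Psi_max (sum_coloring_surj cl cm)
               (sum_coloring_pseudocomplete cl cm pl pm).
Qed.

(** Deleting exactly the vertices colored outside [D] keeps every edge that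
    realizes a pair of colors of [D]. *)
Lemma Psi_delete_color_bound (G : sgraph) (C : finType) (l : G -> C)
    (D : {set C}) :
  D \subset codom l -> {in D &, forall i j, i != j -> meets l i j} ->
  #|D| <= Psi (delete (l @^-1: ~: D)).
Proof.
move=> /subsetP sD mD; pose S := ~: (l @^-1: ~: D).
have inS x : (x \in S) = (l x \in D) by rewrite !inE negbK.
have lD (w : delete (l @^-1: ~: D)) : l (val w) \in D.
  by rewrite -inS; apply: valP w.
pose f (w : delete (l @^-1: ~: D)) : {: {c | c \in D}} := Sub (l (val w)) (lD w).
have -> : #|D| = #|{: {c | c \in D}}| by rewrite card_sig.
apply: (@Psi_max (delete (l @^-1: ~: D)) _ f).
  apply/forallP => -[c cD]; have /codomP[x cx] := sD c cD.
  have xS : x \in S by rewrite inS -cx.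
  by apply/existsP; exists (Sub x xS); apply/eqP/val_inj.
apply/forallP => i; apply/forallP => j; apply/implyP => ij.
have /existsP[u /existsP[v /andP[uv /eqP e]]] :=
  mD _ _ (valP i) (valP j) ij.
have ijD : [set val i; val j] \subset D.
  by rewrite subUset !sub1set; apply/andP; split; [apply: (valP i) | apply: (valP j)].
have uS : u \in S by rewrite inS (subsetP ijD) // -e set21.
have vS : v \in S by rewrite inS (subsetP ijD) // -e set22.
apply/existsP; exists (Sub u uS); apply/existsP; exists (Sub v vS).
apply/andP; split=> //; apply/eqP/(imset_inj val_inj).
by rewrite !imsetU !imset_set1 /= e.
Qed.

Lemma critical_delete (G : sgraph) (X : {set G}) :
  critical G -> uphalf #|X| + Psi (delete X) <= Psi G.
Proof.
move=> cG; rewrite addnC -(subnKC (Psi_delete X)) leq_add2l.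
exact: leq_trans (cG _ (max_card _)) (mpd_le X).
Qed.

(** Each color of [M] occurs on a deleted vertex, so at least [#|M|] vertices
    are deleted, and by criticality this costs at least half as many colors. *)
Lemma critical_color_bound (G : sgraph) (C : finType) (l : G -> C)
    (D M : {set C}) :
  critical G -> D \subset codom l -> M \subset codom l -> [disjoint M & D] ->
  {in D &, forall i j, i != j -> meets l i j} ->
  uphalf #|M| + #|D| <= Psi G.
Proof.
move=> cG sD /subsetP sM dMD mD.
apply: leq_trans (critical_delete (l @^-1: ~: D) cG).
apply: leq_add (Psi_delete_color_bound sD mD); apply: uphalf_leq.
apply: leq_trans (leq_imset_card l _); apply/subset_leq_card/subsetP => c cM.
have /codomP[x cx] := sM c cM; rewrite cx imset_f // !inE -cx.
by rewrite (disjointFr dMD cM).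
Qed.

Lemma join_coloring_card_le (G H : sgraph) (C : finType)
    (l : graph_join G H -> C) :
  coloring l -> pseudocomplete l -> critical G -> critical H ->
  #|C| <= Psi G + Psi H.
Proof.
move=> /forallP cl /pseudocompleteP pl cG cH.
pose lG : G -> C := l \o inl; pose lH : H -> C := l \o inr.
have lGH c : (c \in codom lG) || (c \in codom lH).
  have /existsP[[u|v] /eqP <-] := cl c.
    by rewrite (codom_f lG u).
  by rewrite (codom_f lH v) orbT.
pose A := [set c | c \notin codom lH]; pose B := [set c | c \notin codom lG].
pose M := [set c | (c \in codom lG) && (c \in codom lH)].
have bG : uphalf #|M| + #|A| <= Psi G.
  apply: (critical_color_bound (l := lG) cG).
  - apply/subsetP => c; rewrite inE; have := lGH c.
    by case: (c \in codom lH); rewrite ?orbF.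
  - by apply/subsetP => c; rewrite inE => /andP[].
  - by apply/pred0P => c /=; rewrite !inE -andbA andbN andbF.
  move=> i j; rewrite !inE => iA jA ij.
  apply: meets_preimage (pl i j ij) => // -[u|v]; first by exists u.
  by rewrite !inE => /orP[] /eqP e; [move: iA | move: jA];
     rewrite -e (codom_f lH v).
have bH : uphalf #|M| + #|B| <= Psi H.
  apply: (critical_color_bound (l := lH) cH).
  - by apply/subsetP => c; rewrite inE; have := lGH c; case: (c \in codom lG).
  - by apply/subsetP => c; rewrite inE => /andP[].
  - by apply/pred0P => c /=; rewrite !inE andbAC andbN.
  move=> i j; rewrite !inE => iB jB ij.
  apply: meets_preimage (pl i j ij) => // -[u|v]; last by exists v.
  by rewrite !inE => /orP[] /eqP e; [move: iB | move: jB];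
     rewrite -e (codom_f lG u).
have cover : [set: C] = M :|: (A :|: B).
  apply/setP => c; rewrite !inE.
  by case: (c \in codom lG); case: (c \in codom lH).
rewrite -cardsT cover; apply: leq_trans (leq_add bG bH).
rewrite addnACA; apply: leq_trans (leq_card_setU _ _) _.
apply: leq_add (leq_card_setU _ _).
by rewrite addnn -leq_uphalf_double.
Qed.

Theorem theorem3p3 (G H : sgraph) (hG : critical G) (hH : critical H) :
  Psi (graph_join G H) = Psi G + Psi H.
Proof.
apply/eqP; rewrite eqn_leq Psi_join_ge andbT.
have /existsP[l /andP[cl pl]] := Psi_attained (graph_join G H).
by rewrite -[X in X <= _]card_ord (join_coloring_card_le cl pl).
Qed.
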